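(* Let $P=\{p_i:i\in[k]\}$ be a family of distinct points in $\mathbb{M}_Z^n\setminus\{o\}$, with $\|p_i\|_Z^{-1}p_i$ in the relative interior of the face $F(X_i)$ of $Z_n$, where $X_i\in\mathcal{Z}_n$. Then the star connecting the points of $P$ to $o$ is an SMT of $P\cup\{o\}$ if and only if there do not exist indices $a,b,c,d\in[k]$ with $\{a,b\}\cap\{c,d\}=\emptyset$ and $(X_a^+\cup X_c^+)\cap(X_b^-\cup X_d^-)=\emptyset$. Consequently, the star connecting the points of $P$ to $o$ is an SMT of $P\cup\{o\}$ if and only if for every $I\subseteq[k]$ with $2\leq|I|\leq 4$, the star connecting the points of $\{p_i:i\in I\}$ to $o$ is an SMT of $\{p_i:i\in I\}\cup\{o\}$.
   Context: $[k]=\{1,\dots,k\}$. A Steiner tree of a finite set $N$ in a finite-dimensional normed space is a finite tree $T$ whose vertex set $V(T)$ is a finite set of points of the space with $N\subseteq V(T)$; its length is $\ell(T)=\sum_{xy\in E(T)}\|x-y\|$. A Steiner minimal tree (SMT) of $N$ is a Steiner tree of $N$ of minimum length. The star connecting a finite set of points to $o$ is the tree whose edges join $o$ to each of these points. A signed subset of $[n+1]$ is a vector $X\in\{0,\pm1\}^{n+1}$; $X^+=\{i:X(i)=1\}$, $X^-=\{i:X(i)=-1\}$, $X^0=\{i:X(i)=0\}$, and one writes $X=(X^+,X^-)$; $\emptyset$ also denotes the empty signed set. Let $\mathcal{Z}_n=\{X\in\{0,\pm1\}^{n+1}:X^+\neq\emptyset,\ X^-\neq\emptyset\}\cup\{\emptyset\}$.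 The space $\mathbb{M}^n_Z$ is represented as the hyperplane $H=\{x\in\mathbb{R}^{n+1}:\sum_{i=1}^{n+1}x(i)=0\}$ with norm $\|x\|_Z=\tfrac12\left(\max_{i}x(i)-\min_{i}x(i)\right)$; its unit ball is $Z_n=\pi([-1,1]^{n+1})$, where $\pi:\mathbb{R}^{n+1}\to H$ is the orthogonal projection (this space is isometric to $\mathbb{R}^n$ with unit ball $\operatorname{conv}([0,1]^n\cup[-1,0]^n)$). With $e_1,\dots,e_{n+1}$ the standard basis, the non-empty faces of $Z_n$ are the sets $F(X)=\sum_{i\in X^+}\pi(e_i)-\sum_{j\in X^-}\pi(e_j)+\sum_{k\in X^0}[-\pi(e_k),\pi(e_k)]$, $X\in\mathcal{Z}_n$ (Minkowski sum of points and segments). Each boundary point of $Z_n$ lies in the relative interior of $F(X)$ for a unique $X\in\mathcal{Z}_n$. *)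

(* Defs.v *)
From HB Require Import structures.
From mathcomp Require Import all_boot all_order all_algebra finmap.
From mathcomp Require Import all_classical all_reals.
From mathcomp Require Import topology normedtype.
Set Implicit Arguments.
Unset Strict Implicit.
Unset Printing Implicit Defensive.
Import Order.TTheory GRing.Theory Num.Theory numFieldNormedType.Exports.
Local Open Scope classical_set_scope.
Local Open Scope ring_scope.

(* [ucycle e [:: x; y]] traverses a single edge back and forth, so only cyclic
   sequences of size at least 3 are cycles of the graph. *)
Definition is_tree (V : finType) (e : rel V) : Prop :=
  [/\ symmetric e, irreflexive e, (0 < #|V|)%N,
      forall x y, connect e x y
    & forall c : seq V, ucycle e c -> (size c <= 2)%N].

Record geom_graph (E : choiceType) := GeomGraph {
  vertices : {fset E};
  adj : rel vertices }.

Section Steiner.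
Variables (R : realType) (E : normedModType R).

(* Each edge occurs in the double sum once per orientation. *)
Definition glength (T : geom_graph E) : R :=
  2^-1 * \sum_(x : vertices T) \sum_(y : vertices T | adj x y)
           `|val x - val y|.

Definition steiner_tree (N : {fset E}) (T : geom_graph E) : Prop :=
  is_tree (@adj E T) /\ (N `<=` vertices T)%fset.

Definition SMT (N : {fset E}) (T : geom_graph E) : Prop :=
  steiner_tree N T /\
  forall T' : geom_graph E, steiner_tree N T' -> glength T <= glength T'.

(* Two vertices are adjacent iff exactly one of them is the origin. *)
Definition star (P : {fset E}) : geom_graph E :=
  @GeomGraph E (0 |` P)%fset (fun x y => (val x == 0) (+) (val y == 0)).

Definition affine_hull (A : set E) : set E :=
  [set x | exists (m : nat) (a : 'I_m -> E) (t : 'I_m -> R),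
     [/\ forall i, A (a i), \sum_i t i = 1 & x = \sum_i t i *: a i]].

Definition relative_interior (A : set E) : set E :=
  [set x | A x /\ within (affine_hull A) (nbhs x) A].

Definition segment (a b : E) : set E :=
  [set (1 - t) *: a + t *: b | t in [set t : R | 0 <= t <= 1]].

End Steiner.

Section HyperplaneSpace.
Variables (R : realType) (n : nat).

Definition hyperplane : {pred 'rV[R]_n.+1} :=
  [pred x : 'rV[R]_n.+1 | \sum_i x ord0 i == 0].

Lemma hyperplane_submod_closed : submod_closed hyperplane.
Proof.
split=> [|a x y]; rewrite !inE; first by rewrite big1// => i _; rewrite mxE.
move=> /eqP hx /eqP hy; apply/eqP.
under eq_bigr do rewrite !mxE.
by rewrite big_split/= -mulr_sumr hx hy mulr0 addr0.
Qed.

HB.instance Definition _ :=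
  GRing.isSubmodClosed.Build R 'rV[R]_n.+1 hyperplane hyperplane_submod_closed.

Record MZ := MkMZ { MZval :> 'rV[R]_n.+1; MZvalP : MZval \in hyperplane }.

HB.instance Definition _ := [isSub for MZval].
HB.instance Definition _ := [Choice of MZ by <:].
HB.instance Definition _ := [SubChoice_isSubLmodule of MZ by <:].

Definition max_coord (x : 'rV[R]_n.+1) : R :=
  \big[Num.max/x ord0 ord0]_i x ord0 i.
Definition min_coord (x : 'rV[R]_n.+1) : R :=
  \big[Num.min/x ord0 ord0]_i x ord0 i.

Definition normZ (x : MZ) : R := 2^-1 * (max_coord x - min_coord x).

Lemma max_coord_ge (x : 'rV[R]_n.+1) i : x ord0 i <= max_coord x.
Proof. exact: le_bigmax. Qed.

Lemma min_coord_le (x : 'rV[R]_n.+1) i : min_coord x <= x ord0 i.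
Proof. exact: bigmin_le. Qed.

Lemma max_coord_le (x : 'rV[R]_n.+1) c :
  (forall i, x ord0 i <= c) -> max_coord x <= c.
Proof. by move=> h; apply: bigmax_le. Qed.

Lemma min_coord_ge (x : 'rV[R]_n.+1) c :
  (forall i, c <= x ord0 i) -> c <= min_coord x.
Proof. by move=> h; apply: le_bigmin. Qed.

Lemma max_coordN (x : 'rV[R]_n.+1) : max_coord (- x) = - min_coord x.
Proof.
apply/eqP; rewrite eq_le; apply/andP; split.
  by apply: max_coord_le => i; rewrite mxE lerN2 min_coord_le.
rewrite lerNl; apply: min_coord_ge => i.
by rewrite lerNl; have := max_coord_ge (- x) i; rewrite mxE.
Qed.

Lemma max_coordZ a (x : 'rV[R]_n.+1) :
  0 <= a -> max_coord (a *: x) = a * max_coord x.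
Proof.
move=> a0; apply/eqP; rewrite eq_le; apply/andP; split.
  by apply: max_coord_le => i; rewrite mxE ler_wpM2l// max_coord_ge.
move: a0; rewrite [0 <= a]le_eqVlt => /predU1P[<-|a0].
  by rewrite mul0r; have := max_coord_ge (0 *: x) ord0; rewrite mxE mul0r.
rewrite -ler_pdivlMl//; apply: max_coord_le => i.
by rewrite ler_pdivlMl//; have := max_coord_ge (a *: x) i; rewrite mxE.
Qed.

Lemma normZE (x : MZ) :
  normZ x = 2^-1 * (max_coord x + max_coord (- (x : 'rV[R]_n.+1))).
Proof. by rewrite max_coordN. Qed.

Lemma max_coordD (x y : 'rV[R]_n.+1) :
  max_coord (x + y) <= max_coord x + max_coord y.
Proof. by apply: max_coord_le => i; rewrite mxE lerD ?max_coord_ge. Qed.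

Lemma normZ_triangle (x y : MZ) : normZ (x + y) <= normZ x + normZ y.
Proof.
rewrite !normZE -mulrDr ler_wpM2l ?invr_ge0//.
have -> : MZval (x + y) = MZval x + MZval y by [].
by rewrite opprD addrACA lerD ?max_coordD.
Qed.

Lemma normZ_scale (a : R) (x : MZ) : normZ (a *: x) = `|a| * normZ x.
Proof.
rewrite !normZE mulrCA; congr (_ * _); rewrite mulrDr.
have -> : MZval (a *: x) = a *: MZval x by [].
have [a0|a0] := leP 0 a.
  by rewrite -scalerN !max_coordZ// ger0_norm.
rewrite -scaleNr.
have -> : a *: MZval x = (- a) *: (- MZval x) by rewrite scaleNr scalerN opprK.
by rewrite !max_coordZ ?oppr_ge0 ?(ltW a0)// ltr0_norm// addrC.
Qed.

Lemma normZ_eq0 (x : MZ) : normZ x = 0 -> x = 0.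
Proof.
move=> /eqP; rewrite mulf_eq0 invr_eq0 pnatr_eq0/= subr_eq0 => /eqP h.
have c i : x ord0 i = min_coord x.
  by apply/eqP; rewrite eq_le min_coord_le andbT -h max_coord_ge.
have := MZvalP x; rewrite inE; under eq_bigr do rewrite c.
rewrite sumr_const card_ord mulrn_eq0/= => /eqP m0.
by apply/val_inj/rowP => i; rewrite /= c m0 mxE.
Qed.

HB.instance Definition _ :=
  Lmodule_isNormed.Build R MZ normZ_triangle normZ_scale normZ_eq0.

Definition proj_row (x : 'rV[R]_n.+1) : 'rV[R]_n.+1 :=
  x - const_mx ((\sum_i x ord0 i) / n.+1%:R).

Lemma proj_row_hyperplane x : proj_row x \in hyperplane.
Proof.
rewrite inE; under eq_bigr do rewrite !mxE.
rewrite big_split/= sumr_const card_ord mulNrn -[_ *+ _]mulr_natr.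
by rewrite divfK ?pnatr_eq0// subrr.
Qed.

Definition proj (x : 'rV[R]_n.+1) : MZ := MkMZ (proj_row_hyperplane x).

Lemma proj_orthogonal (x : 'rV[R]_n.+1) (h : MZ) :
  \sum_i (x - proj x) ord0 i * h ord0 i = 0.
Proof.
rewrite /= /proj_row; under eq_bigr do rewrite subKr mxE.
by have := MZvalP h; rewrite inE -mulr_sumr => /eqP ->; rewrite mulr0.
Qed.

Definition pe (i : 'I_n.+1) : MZ := proj (delta_mx ord0 i).

End HyperplaneSpace.

Section SignedSubsets.
Variable n : nat.
Implicit Type X : {ffun 'I_n.+1 -> int}.

Definition signed_subset X : Prop := forall i, X i \in [:: -1; 0; 1].

Definition pos_part X : {set 'I_n.+1} := [set i | X i == 1]%SET.
Definition neg_part X : {set 'I_n.+1} := [set i | X i == -1]%SET.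
Definition zero_part X : {set 'I_n.+1} := [set i | X i == 0]%SET.

Definition Zfamily X : Prop :=
  signed_subset X /\
  ((pos_part X <> finset.set0 /\ neg_part X <> finset.set0) \/ X = [ffun=> 0]).

(* The Minkowski sum of two points and a family of segments, unfolded: [s k] is
   the point chosen in the [k]-th segment. *)
Definition face (R : realType) X : set (MZ R n) :=
  [set \sum_(i in pos_part X) pe R i - \sum_(j in neg_part X) pe R j
       + \sum_(k in zero_part X) s k
  | s in [set s : 'I_n.+1 -> MZ R n |
            forall k, k \in zero_part X -> segment (- pe R k) (pe R k) (s k)]].

End SignedSubsets.

(* Main.v *)
Require Import Defs.
From HB Require Import structures.
From mathcomp Require Import all_boot all_order all_algebra finmap.
From mathcomp Require Import all_classical all_reals.
From mathcomp Require Import topology normedtype.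
From mathcomp Require Import lra.
Set Implicit Arguments.
Unset Strict Implicit.
Unset Printing Implicit Defensive.
Import Order.TTheory GRing.Theory Num.Theory numFieldNormedType.Exports.
Local Open Scope ring_scope.

(* A normalized point lies in the relative interior of [F(X)] exactly when [X^+]
   and [X^-] are the sets of coordinates where the point is maximal, resp. minimal,
   and [(e_u - e_w) / 2] is a norming functional of it for u in X^+, w in X^-.

   If no forbidden quadruple exists, root a competing tree at the origin and move
   from the leaves inwards.  For each subtree, norming functionals of its terminals
   can be chosen with a sum of the form [(e_u - e_w) / 2], where [u] in [X_a^+] and
   [w] in [X_b^-] are still free: when two subtrees with free indices (a, b) and
   (c, d) meet, a common element of [X_a^+ :|: X_c^+] and [X_b^- :|: X_d^-] cancels
   two of the four terms.  These sums have dual norm at most 1, so the tree is at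
   least as long as the star.

   If (a, b, c, d) is forbidden, put A = X_a^+, B = X_b^-, C = X_c^+, D = X_d^- and,
   for small e > 0, join p_a and p_b to s = e pi(1_A - 1_B), p_c and p_d to
   t = e pi(1_C - 1_D), and s and t through (e / 2) pi(1_(A u C) - 1_(B u D)) to the
   origin.  The three new edges cost at most 3 e / 2 and 2 e is saved. *)

(** * Trees described by parent maps *)

Section ParentMap.
Variables (V : finType) (r : V) (par : V -> V) (d : V -> nat).
Hypothesis dpar : forall v, v != r -> (d (par v) < d v)%N.

Definition par_adj : rel V := fun u w =>
  ((u != r) && (par u == w)) || ((w != r) && (par w == u)).

Lemma par_adj_sym : symmetric par_adj.
Proof. by move=> u w; rewrite /par_adj orbC. Qed.

(** Two vertices that are each other's parent would each be strictly less deep than the other. Hence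
    the two orientations in [par_adj] never overlap, as the edge count in [par_adj_sum] requires. *)
Lemma par_adj_disj u w : ~~ [&& u != r, par u == w, w != r & par w == u].
Proof.
apply/negP => /and4P[ur /eqP pu wr /eqP pw].
by have := dpar ur; have := dpar wr; rewrite pu pw => /ltn_trans h /h; rewrite ltnn.
Qed.

Lemma par_adj_max u w : par_adj u w -> (d w <= d u)%N -> par u = w.
Proof.
case/orP => /andP[nr /eqP] //.
by have := dpar nr => + pw; rewrite pw ltnNge => /negPf ->.
Qed.

(** Following parents leads every vertex to the root. A cycle of size at least 3 is impossible,
    because both neighbours of a deepest vertex on it would be its parent. *)
Lemma par_adj_tree : is_tree par_adj.
Proof.
split.
- exact: par_adj_sym.
- move=> u; have := par_adj_disj u u; rewrite /par_adj.
  by case: (u != r); case: (par u == u).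
- by apply/card_gt0P; exists r.
- have root v : connect par_adj r v.
    have [m] := ubnP (d v); elim: m v => // m IH v.
    have [->|vr] := eqVneq v r; first by rewrite connect0.
    rewrite ltnS => dv; apply: (@connect_trans _ _ (par v)).
      by apply: IH; exact: leq_trans (dpar vr) dv.
    by apply: connect1; rewrite /par_adj vr eqxx orbT.
  move=> x y; apply: connect_trans (root y).
  by rewrite (sym_connect_sym par_adj_sym).
- move=> c cyc; rewrite leqNgt; apply/negP => c3.
  have [x0 x0c] : exists x, x \in c.
    by case: c c3 {cyc} => // x c _; exists x; rewrite mem_head.
  pose v := [arg max_(v > x0 | v \in c) d v].
  have [vc vmax] : v \in c /\ forall w, w \in c -> (d w <= d v)%N.
    by rewrite /v; case: arg_maxnP.
  have [i c' rc] := rot_to vc.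
  have := cyc; rewrite -(rot_ucycle i) rc.
  have sc' : (1 < size c')%N by have := c3; rewrite -(size_rot i) rc.
  have cmax w : w \in c' -> (d w <= d v)%N.
    by move=> wc; apply: vmax; rewrite -(mem_rot i) rc inE wc orbT.
  case: c' {rc} sc' cmax => // y [//|z c'] _ cmax.
  case/andP => /= /andP[evy /andP[_ +]] /andP[_ /andP[yc _]].
  rewrite rcons_path => /andP[_ elv]; case/negP: yc.
  have -> : y = last z c'.
    rewrite -(par_adj_max evy) ?cmax ?mem_head//.
    apply: par_adj_max; first by rewrite par_adj_sym.
    by apply: cmax; rewrite inE mem_last orbT.
  by rewrite mem_last.
Qed.

(** Each edge is met once from its child and once from its parent. By symmetry of [f] both visits
    give the same term, so the factor one half leaves one term per child. *)
Lemma par_adj_sum (R : realType) (f : V -> V -> R) :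
  (forall u w, f u w = f w u) ->
  2^-1 * \sum_u \sum_(w | par_adj u w) f u w = \sum_(v | v != r) f v (par v).
Proof.
move=> fC.
have E u : \sum_(w | par_adj u w) f u w =
    \sum_(w | (u != r) && (par u == w)) f u w +
    \sum_(w | (w != r) && (par w == u)) f u w.
  rewrite (bigID (fun w => (u != r) && (par u == w)))/=; congr (_ + _).
    by apply: eq_bigl => w; rewrite /par_adj; case: ((u != r) && _); rewrite ?andbF.
  apply: eq_bigl => w; have := par_adj_disj u w; rewrite /par_adj.
  by case: (u != r); case: (par u == w); case: (w != r); case: (par w == u).
under eq_bigr do rewrite E.
rewrite big_split/= [X in _ + X](exchange_big_dep (fun w => w != r))/=; last first.
  by move=> u w _ /andP[].
have -> : \sum_u \sum_(w | (u != r) && (par u == w)) f u w =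
    \sum_(v | v != r) f v (par v).
  rewrite [RHS]big_mkcond; apply: eq_bigr => u _; case: ifPn => ur /=.
    by rewrite (eq_bigl (pred1 (par u))) ?big_pred1_eq// => w; rewrite /= eq_sym.
  by rewrite big_pred0.
have -> : \sum_(w | w != r) \sum_(u | (w != r) && (par w == u)) f u w =
    \sum_(v | v != r) f v (par v).
  apply: eq_bigr => w ->/=.
  by rewrite (eq_bigl (pred1 (par w))) ?big_pred1_eq// => u; rewrite /= eq_sym.
lra.
Qed.

End ParentMap.

(** [d] is the distance from [r], and [par v] is a neighbour of [v] closer to [r]; the last vertex
    but one of a shortest path shows that there is one. The resulting spanning tree uses edges of
    [e] only, which is enough for a lower bound on length. *)
Lemma connected_par_adj (V : finType) (e : rel V) (r : V) :
  (forall x y, connect e x y) ->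
  exists par (d : V -> nat), forall v, v != r -> e (par v) v /\ (d (par v) < d v)%N.
Proof.
move=> ce.
pose P v m := [exists t : m.-tuple V, path e r t && (last r t == v)].
have exP v : exists m, P v m.
  have /connectP[s ps ->] := ce r v.
  by exists (size s); apply/existsP; exists (in_tuple s); rewrite ps eqxx.
pose d v := ex_minn (exP v).
have dP v : v != r -> exists u, e u v && (d u < d v)%N.
  rewrite {2}/d; case: ex_minnP => m /existsP[t /andP[pt /eqP lt]] _ vr.
  case: m t pt lt => [t|m t]; first by rewrite tuple0/= => _ rv; rewrite rv eqxx in vr.
  case: t => s /= ss; case/lastP: s ss => [//|s x].
  rewrite rcons_path last_rcons size_rcons eqSS => ss /andP[ps ex] xv.
  exists (last r s); rewrite -xv ex/= /d; case: ex_minnP => q _ /(_ m); apply.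
  by apply/existsP; exists (Tuple ss); rewrite ps/=.
(* By [dP] the default [v] is never taken away from the root. *)
exists (fun v => odflt v [pick u | e u v && (d u < d v)%N]), d => v /dP[u uP].
by case: pickP => [w /andP[]//|/(_ u)]; rewrite uP.
Qed.

(** * Trees on point sets of a normed space, rooted at the origin *)

Section Arborescence.
Variables (R : realType) (E : normedModType R).

(** Parent map and depth are functions on the whole space, so that the vertex set can grow without a
    change of type. *)
Definition arborescence (V : {fset E}) (par : E -> E) (d : E -> nat) : Prop :=
  0 \in V /\ forall v, v \in V -> v != 0 -> par v \in V /\ (d (par v) < d v)%N.

Definition par_length (V : {fset E}) (par : E -> E) : R :=
  \sum_(v <- V | v != 0) `|v - par v|.

(** The adjacency [e] only has to agree pointwise with that of the parent map, so that [star], which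
    is defined without one, is covered as well. *)
Lemma par_tree (V : {fset E}) (par : E -> E) (d : E -> nat)
    (e : rel V) : arborescence V par d ->
  (forall u w : V, e u w = (val u != 0) && (par (val u) == val w)
                       || (val w != 0) && (par (val w) == val u)) ->
  is_tree e /\ glength (GeomGraph e) = par_length V par.
Proof.
move=> [V0 Vpar] eE; pose r : V := [` V0]%fset.
(* Away from the root [par] stays in [V], so the default [r] is not taken there. *)
pose par' (v : V) : V := insubd r (par (val v)).
have vr v : (v != r) = (val v != 0) by [].
have par'E v : v != r -> val (par' v) = par (val v).
  by rewrite vr => /(Vpar _ (fsvalP v))[h _]; rewrite /par' insubdK.
have dpar' v : v != r -> (d (val (par' v)) < d (val v))%N.
  by move=> vn; rewrite par'E//; have [] := Vpar _ (fsvalP v) vn.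
have -> : e = par_adj r par'.
  apply/funext => u; apply/funext => w; rewrite eE /par_adj -!vr.
  have h x y : (x != r) && (par (val x) == val y) = (x != r) && (par' x == y).
    by case: (boolP (x != r)) => //= xr; rewrite -val_eqE par'E.
  by rewrite !h.
split; first exact: (par_adj_tree (d := d \o val)).
rewrite /glength (par_adj_sum (d := d \o val))//; last by move=> u w; exact: distrC.
rewrite /par_length (big_seq_fsetE _ _ (fun v => v != 0) (fun v => `|v - par v|))/=.
by apply: eq_bigr => v vn; rewrite -par'E.
Qed.

Lemma star_tree (P : {fset E}) : 0 \notin P ->
  is_tree (@adj E (star P)) /\ glength (star P) = \sum_(q <- P) `|q|.
Proof.
move=> P0.
(* The Boolean [v != 0], read as a number, is the depth: 0 at the origin and 1 elsewhere. *)
have arb : arborescence (0 |` P)%fset (fun=> 0) (fun v => v != 0).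
  by split=> [|v _ ->]; rewrite ?fset1U1 ?eqxx.
have [|tr ->] := par_tree (e := @adj E (star P)) arb.
  by move=> u w /=; rewrite ![0 == _]eq_sym; do 2 case: (_ == 0).
split=> //; rewrite /par_length big_mkcond big_fsetU1//= eqxx add0r.
rewrite big_seq [RHS]big_seq; apply: eq_bigr => v vP; rewrite subr0 ifT//.
by apply: contraNneq P0 => <-.
Qed.

(** A new [y] becomes a child of [x], one level deeper; if [y] is already a vertex, nothing changes
    and only an inequality holds. Steiner points may therefore coincide with each other or with
    terminals. *)
Lemma arborescence_grow (V : {fset E}) par d x y :
  arborescence V par d -> x \in V ->
  exists par' d', arborescence (y |` V)%fset par' d' /\
    par_length (y |` V)%fset par' <= par_length V par + `|x - y|.
Proof.
move=> arb xV; have [yV|yV] := boolP (y \in V).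
  have -> : (y |` V = V)%fset by apply/fsetUidPr; rewrite fsub1set.
  by exists par, d; split=> //; rewrite lerDl.
have [V0 Vpar] := arb.
pose par' v := if v == y then x else par v.
pose d' v := if v == y then (d x).+1 else d v.
have ny v : v \in V -> (v == y) = false.
  by move=> vV; apply: contraNF yV => /eqP <-.
exists par', d'; split.
  split=> [|v]; first by rewrite !inE V0 orbT.
  rewrite /par' /d' in_fset1U; have [_ _ _|_ /= vV v0] := eqVneq v y.
    by rewrite (ny _ xV) in_fset1U xV orbT.
  by have [pV dv] := Vpar _ vV v0; rewrite (ny _ pV) in_fset1U pV orbT.
rewrite /par_length big_mkcond big_fsetU1//= ifT; last first.
  by apply: contraNneq yV => ->.
rewrite -big_mkcond/=.
rewrite /par' eqxx distrC addrC lerD2r le_eqVlt; apply/orP; left; apply/eqP.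
rewrite big_seq_cond [RHS]big_seq_cond; apply: eq_bigr => v /andP[vV _].
by rewrite (ny _ vV).
Qed.

Lemma arborescence_grow_seq (s : seq E) (att : E -> E) (V : {fset E}) par d :
  arborescence V par d -> (forall q, att q \in V) ->
  exists V' par' d', [/\ arborescence V' par' d', (V `<=` V')%fset,
    {subset s <= V'} &
    par_length V' par' <= par_length V par + \sum_(q <- s) `|q - att q| ].
Proof.
elim: s V par d => [|y s IH] V par d arb aV.
  by exists V, par, d; split=> //; rewrite big_nil addr0.
have [par1 [d1 [arb1 len1]]] := arborescence_grow y arb (aV y).
have [|V' [par' [d' [arb' sV ss len']]]] := IH _ _ _ arb1.
  by move=> q; rewrite in_fset1U aV orbT.
exists V', par', d'; split=> //.
- by apply: fsubset_trans sV; exact: fsubsetU1.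
- move=> q; rewrite inE => /predU1P[->|/ss//].
  by apply: (fsubsetP sV); exact: fset1U1.
- by rewrite big_cons; have := len1; rewrite distrC; lra.
Qed.

Lemma SMT_le_par_length (N : {fset E}) T (V : {fset E}) par d :
  SMT N T -> arborescence V par d -> (N `<=` V)%fset ->
  glength T <= par_length V par.
Proof.
move=> [_ minT] arb NV.
pose e : rel V := fun u w => (val u != 0) && (par (val u) == val w)
                       || (val w != 0) && (par (val w) == val u).
have [//|tr <-] := par_tree (e := e) arb.
by apply: minT; split.
Qed.

End Arborescence.

(** * Lower bound *)

Section Geometry.
Variables (R : realType) (n : nat).
Implicit Types (x y : MZ R n) (i j : 'I_n.+1).

Definition argmax x : {set 'I_n.+1} := [set i | x ord0 i == max_coord x]%SET.
Definition argmin x : {set 'I_n.+1} := [set i | x ord0 i == min_coord x]%SET.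

Lemma argmax_ge x i j : i \in argmax x -> x ord0 j <= x ord0 i.
Proof. by rewrite inE => /eqP ->; exact: max_coord_ge. Qed.

Lemma argmin_le x i j : i \in argmin x -> x ord0 i <= x ord0 j.
Proof. by rewrite inE => /eqP ->; exact: min_coord_le. Qed.

Lemma mem_argmax x i : (forall j, x ord0 j <= x ord0 i) -> i \in argmax x.
Proof. by move=> h; rewrite inE eq_le max_coord_ge max_coord_le. Qed.

Lemma mem_argmin x i : (forall j, x ord0 i <= x ord0 j) -> i \in argmin x.
Proof. by move=> h; rewrite inE eq_le min_coord_le min_coord_ge. Qed.

Lemma argmax_ex x : exists i, i \in argmax x.
Proof.
exists [arg max_(i > ord0) x ord0 i]%O.
by case: arg_maxP => // i _ h; apply: mem_argmax => j; exact: h.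
Qed.

Lemma argmin_ex x : exists i, i \in argmin x.
Proof.
exists [arg min_(i < ord0) x ord0 i]%O.
by case: arg_minP => // i _ h; apply: mem_argmin => j; exact: h.
Qed.

Lemma norm_argmax_argmin x i j : i \in argmax x -> j \in argmin x ->
  `|x| = 2^-1 * (x ord0 i - x ord0 j).
Proof. by rewrite !inE => /eqP -> /eqP ->. Qed.

(** The functional [(e_i - e_j) / 2] has dual norm at most 1. *)
Lemma coord_diff_le x i j : x ord0 i - x ord0 j <= 2 * `|x|.
Proof.
have [u ux] := argmax_ex x; have [w wx] := argmin_ex x.
rewrite (norm_argmax_argmin ux wx).
by have := argmax_ge i ux; have := argmin_le j wx; lra.
Qed.

Lemma norm_le_coord_diff x (c : R) :
  (forall i j, x ord0 i - x ord0 j <= 2 * c) -> `|x| <= c.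
Proof.
move=> h; have [u ux] := argmax_ex x; have [w wx] := argmin_ex x.
by rewrite (norm_argmax_argmin ux wx); have := h u w; lra.
Qed.

Lemma argmax_argmin_disj x i : x != 0 -> i \in argmax x -> i \notin argmin x.
Proof.
move=> x0 ix; apply: contra x0 => jx.
by rewrite -normr_eq0 (norm_argmax_argmin ix jx) subrr mulr0.
Qed.

End Geometry.

Section LowerBound.
Variables (R : realType) (n : nat) (I : finType) (p : I -> MZ R n).
Hypothesis no_bad : forall a b c d : I, a != c -> a != d -> b != c -> b != d ->
  (argmax (p a) :|: argmax (p c)) :&: (argmin (p b) :|: argmin (p d))
    != finset.set0.

(* [L] is the length of a tree joining the terminals in [J] to [x].  The
   norming functionals [(e_u - e_w) / 2] of these terminals can be chosen so that
   they telescope to the one displayed, in which the last two choices [u] and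
   [w] are still free. *)
Definition telescopes (x : MZ R n) (L : R) (J : {set I}) : Prop :=
  if J == finset.set0 then is_true (0 <= L) else
  exists a b, [/\ a \in J, b \in J &
    forall u w, u \in argmax (p a) -> w \in argmin (p b) ->
      \sum_(i in J) `|p i| <= L + 2^-1 * (x ord0 u - x ord0 w)].

Lemma telescopes1 i : telescopes (p i) 0 [set i]%SET.
Proof.
rewrite /telescopes ifN; last by apply/finset.set0Pn; exists i; rewrite finset.inE.
exists i, i; split; rewrite ?finset.inE// => u w uM wm.
by rewrite big_set1 add0r (norm_argmax_argmin uM wm).
Qed.

(** The displayed functional has dual norm at most 1, so passing from [x] to [y] changes its value
    by at most the length of the new edge. *)
Lemma telescopes_move x y L J :
  telescopes x L J -> telescopes y (L + `|x - y|) J.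
Proof.
rewrite /telescopes; case: ifP => _; first by move=> h; rewrite addr_ge0.
move=> [a [b [aJ bJ h]]]; exists a, b; split=> // u w uM wm.
have := h u w uM wm; have := coord_diff_le (x - y) u w.
rewrite !mxE; lra.
Qed.

Lemma telescopes_merge x L1 L2 (J1 J2 : {set I}) : [disjoint J1 & J2] ->
  telescopes x L1 J1 -> telescopes x L2 J2 ->
  telescopes x (L1 + L2) (J1 :|: J2)%SET.
Proof.
rewrite /telescopes => J12.
have [->|J1n] := eqVneq J1 finset.set0.
  rewrite finset.set0U; case: ifP => _; first exact: addr_ge0.
  move=> h1 [c [d [cJ dJ h]]]; exists c, d; split=> // u w uM wm.
  by have := h u w uM wm; lra.
have [->|J2n] := eqVneq J2 finset.set0.
  rewrite finset.setU0 (negPf J1n) => -[a [b [aJ bJ h]]] h2.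
  exists a, b; split=> // u w uM wm.
  by have := h u w uM wm; lra.
move=> [a [b [aJ bJ h1]]] [c [d [cJ dJ h2]]].
rewrite ifN; last by rewrite finset.setU_eq0 negb_and J1n.
have neq i j : i \in J1 -> j \in J2 -> i != j.
  by move=> iJ jJ; apply: contraTneq iJ => ->; rewrite (disjointFl J12).
have /finset.set0Pn[z] := no_bad (neq _ _ aJ cJ) (neq _ _ aJ dJ) (neq _ _ bJ cJ) (neq _ _ bJ dJ).
rewrite finset.in_setI !finset.in_setU => /andP[zmax zmin].
have sumE : \sum_(i in (J1 :|: J2)%SET) `|p i| = \sum_(i in J1) `|p i| + \sum_(i in J2) `|p i|.
  by rewrite -bigU//=; apply: eq_bigl => i; rewrite !finset.inE.
rewrite sumE.
have [ua uaM] := argmax_ex (p a); have [wb wbm] := argmin_ex (p b).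
have [uc ucM] := argmax_ex (p c); have [wd wdm] := argmin_ex (p d).
(* The common index [z] fills one free maximum and one free minimum. If both belong to the same
   subtree, its functional vanishes; otherwise [(x_u - x_z) + (x_z - x_w)] telescopes. The other two
   choices stay free. *)
case/orP: zmax => zM; case/orP: zmin => zm.
- exists c, d; split; rewrite ?finset.in_setU ?cJ ?dJ ?orbT// => u w uM wm.
  by have := h1 z z zM zm; have := h2 u w uM wm; lra.
- exists c, b; split; rewrite ?finset.in_setU ?cJ ?bJ ?orbT// => u w uM wm.
  by have := h1 z w zM wm; have := h2 u z uM zm; lra.
- exists a, d; split; rewrite ?finset.in_setU ?aJ ?dJ ?orbT// => u w uM wm.
  by have := h1 u z uM zm; have := h2 z w zM wm; lra.
- exists a, b; split; rewrite ?finset.in_setU ?aJ ?bJ ?orbT// => u w uM wm.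
  by have := h1 u w uM wm; have := h2 z z zM zm; lra.
Qed.

Lemma telescopes_ge x L J : telescopes x L J -> x = 0 -> \sum_(i in J) `|p i| <= L.
Proof.
rewrite /telescopes; case: eqVneq => [-> | _] + x0; first by rewrite big_set0.
move=> [a [b [_ _ h]]]; have [u uM] := argmax_ex (p a).
have [w wm] := argmin_ex (p b); have := h u w uM wm.
by rewrite x0 !mxE subrr mulr0 addr0.
Qed.

(* Leaves are pruned in order of decreasing depth [d]; [g] assigns the terminals
   of the pruned part to the remaining vertices [W]. *)
Lemma sum_norm_le_par_length (V : finType) (r : V) (par : V -> V) (d : V -> nat)
    (f : V -> MZ R n) (W : {set V}) (g : I -> V) (L : V -> R) :
  f r = 0 -> r \in W -> (forall i, g i \in W) ->
  (forall v, v \in W -> v != r -> par v \in W /\ (d (par v) < d v)%N) ->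
  (forall v, v \in W -> telescopes (f v) (L v) [set i | g i == v]%SET) ->
  \sum_i `|p i| <= \sum_(v in W) L v + \sum_(v in W | v != r) `|f v - f (par v)|.
Proof.
move=> fr; have [m] := ubnP #|W|; elim: m W g L => // m IH W g L.
rewrite ltnS => Wm rW gW parW telW.
(* When only the root is left, all terminals are assigned to it and the functional is evaluated at
   the origin. *)
have [Wr|[v0 /andP[v0W v0r]]] : W = [set r]%SET \/ exists v, (v \in W) && (v != r).
  have [/existsP[v vW]|/existsPn h] := boolP [exists v, (v \in W) && (v != r)].
    by right; exists v.
  left; apply/finset.setP => v; rewrite finset.inE; apply/idP/eqP => [vW|->//].
  by apply/eqP; have := h v; rewrite vW/= negbK.
  have := telescopes_ge (telW _ rW) fr.
  rewrite Wr big_set1 [X in _ + X]big_pred0 ?addr0; last first.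
    by move=> v; rewrite !finset.inE; case: (v == r).
  congr (_ <= _); apply: eq_bigl => i; rewrite finset.inE.
  by have := gW i; rewrite Wr finset.inE.
(* A deepest remaining vertex is a leaf: a child of it would be deeper. Its terminals, its length
   and its edge are handed over to its parent. *)
pose v := [arg max_(v > v0 | (v \in W) && (v != r)) d v].
have [/andP[vW vr] vmax] :
    (v \in W) && (v != r) /\ forall u, (u \in W) && (u != r) -> (d u <= d v)%N.
  by rewrite /v; case: arg_maxnP; rewrite ?v0W.
have [pW dv] := parW v vW vr.
have pv : par v != v by apply: contraTneq dv => ->; rewrite ltnn.
pose g' i := if g i == v then par v else g i.
pose L' u := if u == par v then L u + (L v + `|f v - f u|) else L u.
have W'm : (#|(W :\ v)%SET| < m)%N.
  by apply: leq_trans Wm; rewrite [leqRHS](cardsD1 v) vW.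
have := IH _ g' L' W'm; rewrite !finset.inE eq_sym vr rW => /(_ isT).
have g'W i : g' i \in (W :\ v)%SET.
  by rewrite /g' !finset.inE; case: ifPn => [_|->]; rewrite ?pv ?gW.
move=> /(_ g'W).
have parW' u : u \in (W :\ v)%SET -> u != r -> par u \in (W :\ v)%SET /\ (d (par u) < d u)%N.
  rewrite !finset.inE => /andP[uv uW] ur; have [puW du] := parW u uW ur.
  split=> //; rewrite puW andbT; apply: contraTneq du => ->.
  by rewrite -leqNgt vmax// uW.
move=> /(_ parW').
have telW' u : u \in (W :\ v)%SET -> telescopes (f u) (L' u) [set i | g' i == u]%SET.
  rewrite !finset.inE => /andP[uv uW]; rewrite /L'; case: eqVneq => [upv|upv].
    have -> : [set i | g' i == u]%SET = ([set i | g i == u] :|: [set i | g i == v])%SET.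
      apply/finset.setP => i; rewrite !finset.inE /g'; case: (eqVneq (g i) v) => [_|_].
        by rewrite -upv eqxx orbT.
      by rewrite orbF.
    apply: telescopes_merge; [|exact: telW|exact/telescopes_move/telW].
    rewrite -finset.setI_eq0; apply/eqP/finset.setP => i; rewrite !finset.inE.
    by apply: contraNF uv => /andP[/eqP <- /eqP <-].
  have -> : [set i | g' i == u]%SET = [set i | g i == u]%SET; last exact: telW.
  apply/finset.setP => i; rewrite !finset.inE /g'; case: (eqVneq (g i) v) => // ->.
  by rewrite ![_ == u]eq_sym (negPf upv) (negPf uv).
move=> /(_ telW') /le_trans; apply.
(* Only the terms at [v] and [par v] differ between the two bounds. *)
rewrite (big_setD1 v vW)/= (big_setD1 (par v))/=; last by rewrite !finset.inE pv.
rewrite [X in _ <= _ + X + _](big_setD1 (par v))/=; last by rewrite !finset.inE pv.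
rewrite {1}/L' eqxx.
have -> : \sum_(u in (W :\ v) :\ par v) L' u = \sum_(u in (W :\ v) :\ par v) L u.
  by apply: eq_bigr => u; rewrite !finset.inE /L' => /andP[/negPf ->].
rewrite [X in _ <= _ + X](bigD1 v)/=; last by rewrite vW.
rewrite [X in _ + X <= _](eq_bigl (fun u => (u \in W) && (u != r) && (u != v))).
  lra.
by move=> u; rewrite !finset.inE andbC andbA andbAC [(u != r) && _]andbC.
Qed.

Lemma sum_norm_le_glength (T : geom_graph (MZ R n)) :
  injective p -> is_tree (@adj _ T) -> 0 \in vertices T ->
  (forall i, p i \in vertices T) -> \sum_i `|p i| <= glength T.
Proof.
move=> p_inj [esym _ _ econn _] T0 pT; pose r : vertices T := [` T0]%fset.
have [par [d dP]] := connected_par_adj r econn.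
have dpar v vr := (dP v vr).2.
pose g i : vertices T := [` pT i]%fset.
have tel v : v \in [set: vertices T]%SET ->
    telescopes (val v) 0 [set i | g i == v]%SET.
  (* By injectivity of [p] a vertex carries at most one terminal at the start. *)
  move=> _; have [i /eqP giv|h] := pickP (fun i => g i == v).
    have -> : [set i | g i == v]%SET = [set i]%SET.
      apply/finset.setP => j; rewrite !finset.inE -giv -val_eqE/=.
      by rewrite (inj_eq p_inj).
    by rewrite -giv; exact: telescopes1.
  rewrite /telescopes ifT//; apply/eqP/finset.setP => i; rewrite !finset.inE.
  exact: h.
have := @sum_norm_le_par_length _ r par d val finset.setT g (fun=> 0) erefl.
rewrite finset.in_setT => /(_ isT).
move=> /(_ (fun=> finset.in_setT _)).
move=> /(_ (fun v _ vr => conj (finset.in_setT _) (dpar v vr)) tel).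
rewrite [X in X + _]big1// add0r => /le_trans; apply.
rewrite (eq_bigl (fun v => v != r)); last by move=> v; rewrite finset.inE.
rewrite -(par_adj_sum dpar (f := fun u w => `|val u - val w|)); last first.
  by move=> u w; exact: distrC.
(* The edges of the spanning tree are among those of [T], so the double sums compare term by
   term. *)
rewrite /glength ler_wpM2l ?invr_ge0//; apply: ler_sum => u _.
rewrite [leRHS]big_mkcond [leLHS]big_mkcond; apply: ler_sum => w _.
case: ifPn => [|_]; last by case: ifP.
by case/orP => /andP[nr /eqP <-]; rewrite ?(esym u) (dP _ nr).1.
Qed.

End LowerBound.

(** * A shorter tree *)

Section UpperBound.
Variables (R : realType) (n : nat).
Implicit Types (x q : MZ R n) (A B S T : {set 'I_n.+1}) (i j : 'I_n.+1).

Definition signed_step A B : MZ R n :=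
  Defs.proj (\row_i ((i \in A)%:R - (i \in B)%:R)).

(** The projection subtracts the same constant from all coordinates; the norm does not see this
    constant. *)
Lemma signed_stepE A B :
  exists c, forall i, signed_step A B ord0 i = (i \in A)%:R - (i \in B)%:R - c.
Proof. by eexists => i; rewrite !mxE. Qed.

Lemma norm_le_coord x (c k : R) :
  (forall i, c - k <= x ord0 i <= c + k) -> `|x| <= k.
Proof.
move=> h; apply: norm_le_coord_diff => i j.
by have /andP[_ +] := h i; have /andP[+ _] := h j; lra.
Qed.

(** The width [2 * e] leaves room for the maximum to fall by [e] while another coordinate rises by
    [e], and likewise for the minimum. *)
Definition coord_gap (e : R) x : Prop :=
  (forall i, i \notin argmax x -> x ord0 i + 2 * e <= max_coord x) /\
  (forall i, i \notin argmin x -> min_coord x + 2 * e <= x ord0 i).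

Lemma coord_gap_near x : \forall e \near at_right (0 : R), coord_gap e x.
Proof.
have gap (u w : R) : u < w -> \forall e \near at_right (0 : R), u + 2 * e <= w.
  move=> uw; have h : 0 < (w - u) / 2 by rewrite divr_gt0// subr_gt0.
  near=> e; have : e < (w - u) / 2 by near: e; exact: nbhs_right_lt.
  by lra.
have gM : \forall e \near at_right (0 : R), forall i,
    i \notin argmax x -> x ord0 i + 2 * e <= max_coord x.
  apply: filter_forall => i; have [_|ni] := boolP (i \in argmax x).
    by near=> e.
  have : x ord0 i < max_coord x.
    by rewrite lt_neqAle max_coord_ge andbT; move: ni; rewrite finset.inE.
  by move/gap; apply: filterS.
have gm : \forall e \near at_right (0 : R), forall i,
    i \notin argmin x -> min_coord x + 2 * e <= x ord0 i.
  apply: filter_forall => i; have [_|ni] := boolP (i \in argmin x).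
    by near=> e.
  have : min_coord x < x ord0 i.
    by rewrite lt_neqAle min_coord_le andbT; move: ni; rewrite finset.inE eq_sym.
  by move/gap; apply: filterS.
near=> e; split; near: e; [exact: gM|exact: gm].
Unshelve. all: by end_near. Qed.

(** No maximal coordinate rises, as [argmax x] avoids [B], and no minimal one falls, as [A] avoids
    [argmin x]. If [A] is all of [argmax x], the maximum drops by [e]; if [B] is all of [argmin x],
    the minimum rises by [e]. Each saves [e / 2] in the norm. *)
Lemma norm_sub_signed_step x A B (e : R) : 0 < e -> coord_gap e x ->
  A :&: B = finset.set0 -> argmax x :&: B = finset.set0 ->
  A :&: argmin x = finset.set0 ->
  `|x - e *: signed_step A B| <=
    `|x| - 2^-1 * e * ((argmax x == A)%:R + (argmin x == B)%:R).
Proof.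
move=> e0 [gM gm] AB MB Am; have [c cE] := signed_stepE A B.
have disj (S T : {set 'I_n.+1}) : S :&: T = finset.set0 ->
    forall i, i \in S -> i \in T -> False.
  by move=> ST i iS iT; have := finset.in_set0 i; rewrite -ST finset.in_setI iS iT.
have nE : `|x| = 2^-1 * (max_coord x - min_coord x) by [].
(* Adding [c] back leaves the bare difference of indicators; [c] cancels between [up] and [lo]. *)
have up i : x ord0 i - e * (signed_step A B ord0 i + c) <=
    max_coord x - e * (argmax x == A)%:R.
  rewrite cE; have [iM|iM] := boolP (i \in argmax x).
    have -> : (i \in B) = false by apply/negP; exact: (disj _ _ MB).
    have := max_coord_ge x i; case: eqVneq => [<-|_]; rewrite ?iM /=; first by lra.
    by case: (i \in A) => /=; lra.
  have := gM i iM; case: (argmax x == A); case: (i \in A); case: (i \in B) => /=; lra.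
have lo i : min_coord x + e * (argmin x == B)%:R <=
    x ord0 i - e * (signed_step A B ord0 i + c).
  rewrite cE; have [im|im] := boolP (i \in argmin x).
    have -> : (i \in A) = false by apply/negP => /(disj _ _ Am); exact.
    have := min_coord_le x i; case: eqVneq => [<-|_]; rewrite ?im /=; first by lra.
    by case: (i \in B) => /=; lra.
  have := gm i im; case: (argmin x == B); case: (i \in A); case: (i \in B) => /=; lra.
have E i : (x - e *: signed_step A B) ord0 i = x ord0 i - e * signed_step A B ord0 i.
  by rewrite !mxE.
apply: norm_le_coord_diff => i j; have := up i; have := lo j.
rewrite nE !E; lra.
Qed.

Lemma norm_signed_step_le A B (e : R) : 0 < e ->
  `|(2^-1 * e) *: signed_step A B| <= 2^-1 * e.
Proof.
move=> e0; have [c cE] := signed_stepE A B.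
apply: (@norm_le_coord _ (- (2^-1 * e * c))) => i.
have -> : ((2^-1 * e) *: signed_step A B) ord0 i =
    2^-1 * e * signed_step A B ord0 i by rewrite mxE.
by rewrite cE; case: (i \in A); case: (i \in B) => /=; apply/andP; split; lra.
Qed.

(** Up to a constant, the coordinates are [- e / 2] on [A] and on [T] outside [B], [e / 2] on [B]
    and on [S] outside [A], and 0 elsewhere. This balance is the reason for halving the outer
    step. *)
Lemma norm_signed_step_sub A B S T (e : R) : 0 < e ->
  A \subset S -> B \subset T -> S :&: T = finset.set0 ->
  `|(2^-1 * e) *: signed_step S T - e *: signed_step A B| <= 2^-1 * e.
Proof.
move=> e0 /fintype.subsetP AS /fintype.subsetP BT ST.
have [c cE] := signed_stepE A B; have [c' c'E] := signed_stepE S T.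
apply: (@norm_le_coord _ (e * c - 2^-1 * e * c')) => i.
have -> : ((2^-1 * e) *: signed_step S T - e *: signed_step A B) ord0 i =
    2^-1 * e * signed_step S T ord0 i - e * signed_step A B ord0 i.
  by rewrite !mxE.
rewrite cE c'E; have := AS i; have := BT i; have := finset.in_set0 i.
rewrite -ST finset.in_setI {AS BT ST cE c'E}.
case: (i \in A); case: (i \in B); case: (i \in S); case: (i \in T) => //= _ h1 h2.
all: try by have := h1 isT.
all: try by have := h2 isT.
all: by apply/andP; split; lra.
Qed.

Lemma sum_eq_uniq (K : choiceType) (P : {fset K}) a : a \in P ->
  \sum_(q <- P) ((q == a)%:R : R) = 1.
Proof.
move=> aP; rewrite (bigD1_seq a)//= eqxx big1 ?addr0// => q /negPf ->.
by [].
Qed.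

(** Each of the four indices saves [e / 2]. If [a = b] or [c = d], the same terminal saves twice, so
    the total is [2 * e] in all cases. *)
Lemma star_not_SMT (P : {fset MZ R n}) (a b c d : MZ R n) : 0 \notin P ->
  a \in P -> b \in P -> c \in P -> d \in P ->
  a != c -> a != d -> b != c -> b != d ->
  (argmax a :|: argmax c) :&: (argmin b :|: argmin d) = finset.set0 ->
  ~ SMT (0 |` P)%fset (star P).
Proof.
move=> P0 aP bP cP dP ac ad bc bd disj smt.
have n0 q : q \in P -> q != 0 by move=> qP; apply: contraNneq P0 => <-.
have sub0 (S S' T T' : {set 'I_n.+1}) : S \subset S' -> T \subset T' ->
    S' :&: T' = finset.set0 -> S :&: T = finset.set0.
  by move=> SS TT ST; apply/eqP; rewrite -finset.subset0 -ST finset.setISS.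
have maxmin q : q \in P -> argmax q :&: argmin q = finset.set0.
  move=> qP; apply/finset.setP => i; rewrite finset.in_setI finset.in_set0.
  have [iM/=|//] := boolP (i \in argmax q).
  exact/negbTE/argmax_argmin_disj/iM/n0.
have abI : argmax a :&: argmin b = finset.set0.
  by apply: sub0 disj; exact: finset.subsetUl.
have cdI : argmax c :&: argmin d = finset.set0.
  by apply: sub0 disj; exact: finset.subsetUr.
have [e [e0 ga gb gc gd]] : exists e : R, [/\ 0 < e, coord_gap e a,
    coord_gap e b, coord_gap e c & coord_gap e d].
  near (at_right (0 : R)) => e; exists e.
  by split; near: e; [exact: nbhs_right_gt|exact: coord_gap_near..].
pose s := e *: signed_step (argmax a) (argmin b).
pose t := e *: signed_step (argmax c) (argmin d).
pose r := (2^-1 * e) *: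
  signed_step (argmax a :|: argmax c) (argmin b :|: argmin d).
have step q x y : q \in P -> (q == x) || (q == y) -> coord_gap e x ->
    coord_gap e y -> argmax x :&: argmin y = finset.set0 ->
    `|q - e *: signed_step (argmax x) (argmin y)| <=
      `|q| - 2^-1 * e * ((q == x)%:R + (q == y)%:R).
  move=> qP qxy gx gy xyI.
  have gq : coord_gap e q by case/orP: qxy => /eqP ->.
  have := @norm_sub_signed_step q (argmax x) (argmin y) e e0 gq xyI.
  have -> : argmax q :&: argmin y = finset.set0.
    by case/orP: qxy => /eqP qE; [rewrite qE|rewrite -qE maxmin].
  have -> : argmax x :&: argmin q = finset.set0.
    by case/orP: qxy => /eqP qE; [rewrite -qE maxmin|rewrite qE].
  (* Distinct points may share a set of extremal coordinates, so [q == x] only bounds the true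
     indicator from below. *)
  move=> /(_ erefl erefl) /le_trans; apply; rewrite lerD2l lerN2 ler_wpM2l ?lerD//.
  - by rewrite mulr_ge0 ?invr_ge0// ltW.
  - by rewrite ler_nat; case: eqVneq => [->|//]; rewrite eqxx.
  - by rewrite ler_nat; case: eqVneq => [->|//]; rewrite eqxx.
(* Terminals other than the four stay joined to the origin. *)
pose att q := if (q == a) || (q == b) then s else
              if (q == c) || (q == d) then t else 0.
have attP q : q \in P -> `|q - att q| <= `|q| - 2^-1 * e *
    (((q == a)%:R + (q == b)%:R) + ((q == c)%:R + (q == d)%:R)).
  move=> qP; rewrite /att; case: ifPn => [qab|].
    have -> : (q == c) = false by apply/negbTE; case/orP: qab => /eqP ->.
    have -> : (q == d) = false by apply/negbTE; case/orP: qab => /eqP ->.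
    by rewrite !addr0; exact: step.
  rewrite negb_or => /andP[/negPf -> /negPf ->]; rewrite !add0r.
  case: ifPn => [qcd|]; first exact: step.
  by rewrite negb_or => /andP[/negPf -> /negPf ->]; rewrite addr0 mulr0 !subr0.
have nr : `|0 - r| <= 2^-1 * e by rewrite sub0r normrN norm_signed_step_le.
have nrs : `|r - s| <= 2^-1 * e.
  by apply: norm_signed_step_sub; rewrite ?finset.subsetUl.
have nrt : `|r - t| <= 2^-1 * e.
  by apply: norm_signed_step_sub; rewrite ?finset.subsetUr.
have arb0 : arborescence [fset (0 : MZ R n)]%fset id (fun=> 0%N).
  by split=> [|v]; rewrite in_fset1// => ->.
have len0 : par_length [fset (0 : MZ R n)]%fset id = 0.
  by rewrite /par_length big_mkcond big_seq_fset1 eqxx.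
(* Starting from the origin alone, [r] is attached first, then [s] and [t] to [r], and finally the
   terminals through [att]. *)
have [|par1 [d1 [arb1 len1]]] := arborescence_grow r arb0 (x := 0).
  by rewrite in_fset1.
have [|par2 [d2 [arb2 len2]]] := arborescence_grow s arb1 (x := r).
  exact: fset1U1.
have [|par3 [d3 [arb3 len3]]] := arborescence_grow t arb2 (x := r).
  by rewrite !in_fset1U eqxx orbT.
have [|V [par [dd [arb sV PV len]]]] := arborescence_grow_seq P arb3 (att := att).
  move=> q; rewrite /att; case: ifP => _; [|case: ifP => _].
  - by rewrite !in_fset1U eqxx orbT.
  - by rewrite !in_fset1U eqxx.
  - by rewrite !in_fset1U in_fset1 eqxx !orbT.
have : glength (star P) <= par_length V par.
  apply: SMT_le_par_length smt arb _; apply/fsubsetP => q; rewrite in_fset1U.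
  by case/predU1P => [->|/PV//]; apply: (fsubsetP sV); rewrite !in_fset1U in_fset1 eqxx !orbT.
rewrite (star_tree P0).2.
have : \sum_(q <- P) `|q - att q| <= \sum_(q <- P) `|q| - 2 * e.
  have -> : \sum_(q <- P) `|q| - 2 * e = \sum_(q <- P) (`|q| - 2^-1 * e *
      (((q == a)%:R + (q == b)%:R) + ((q == c)%:R + (q == d)%:R))).
    rewrite sumrB; congr (_ - _).
    by rewrite -mulr_sumr !big_split/= !sum_eq_uniq//; lra.
  by rewrite big_seq [leRHS]big_seq; apply: ler_sum => q; exact: attP.
move: len1 len2 len3 len; rewrite len0; lra.
Unshelve. all: by end_near. Qed.

End UpperBound.

(** * Faces of the unit ball *)

Section RelativeInterior.
Variables (R : realType) (n : nat).
Implicit Types (X : {ffun 'I_n.+1 -> int}) (x : MZ R n) (i j k : 'I_n.+1).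

(** The segment from [y] to [x] can be prolonged beyond [x]: the prolongation is an affine
    combination with coefficients [1 + d] and [- d], and it stays near [x] for small [d]. *)
Lemma relative_interior_extend (E : normedModType R) (A : set E) (x y : E) :
  relative_interior A x -> A y ->
  exists2 e : R, 0 < e & A (x + e *: (x - y)).
Proof.
move=> [Ax]; rewrite /within => /nbhs_normP[e /= e0 eA] Ay.
(* The summand 1 keeps the denominator positive when [x = y]. *)
pose d := e / 2 / (`|x - y| + 1).
have n1 : 0 < `|x - y| + 1 by rewrite ltr_wpDl.
have d0 : 0 < d by rewrite !divr_gt0.
exists d => //; apply: eA => /=.
  rewrite opprD addNKr normrN normrZ gtr0_norm// /d -mulrA.
  rewrite -[ltRHS]mulr1 -mulrA ltr_pM2l// mulrC mulrA ltr_pdivrMr//.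
  have := normr_ge0 (x - y); lra.
exists 2%N, (fun l : 'I_2 => if l == ord0 then x else y),
  (fun l : 'I_2 => if l == ord0 then 1 + d else - d); split.
- by move=> i; case: ifP.
- by rewrite big_ord_recl big_ord1/= addrK.
- by rewrite big_ord_recl big_ord1/= scalerDl scale1r scalerBr scaleNr addrA.
Qed.

Fact proj_linear : linear (@Defs.proj R n).
Proof.
move=> a x y; apply/val_inj/rowP => i; rewrite !mxE.
under eq_bigr do rewrite !mxE.
by rewrite big_split/= -mulr_sumr mulrDl mulrBr opprD -!mulrA addrACA.
Qed.

HB.instance Definition _ :=
  GRing.isLinear.Build R 'rV[R]_n.+1 (MZ R n) _ (@Defs.proj R n) proj_linear.

Lemma proj_sum (y : 'rV[R]_n.+1) : Defs.proj y = \sum_i y ord0 i *: pe R i.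
Proof.
rewrite {1}[y]row_sum_delta linear_sum; apply: eq_bigr => i _.
by rewrite linearZ.
Qed.

Lemma proj_coord_diff (y : 'rV[R]_n.+1) i j :
  Defs.proj y ord0 i - Defs.proj y ord0 j = y ord0 i - y ord0 j.
Proof. by rewrite !mxE opprB addrA subrK. Qed.

(** The face of the cube [[-1, 1]^(n+1)] that the projection maps onto F(X). *)
Definition face_coords X (y : 'rV[R]_n.+1) : Prop := forall i,
  [/\ -1 <= y ord0 i <= 1, X i = 1 -> y ord0 i = 1 & X i = -1 -> y ord0 i = -1].

Lemma faceP X x : signed_subset X ->
  face X x <-> exists2 y, face_coords X y & x = Defs.proj y.
Proof.
move=> sX.
have split_sum (F : 'I_n.+1 -> MZ R n) : \sum_i F i =
    \sum_(i in pos_part X) F i + \sum_(i in neg_part X) F i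
      + \sum_(i in zero_part X) F i.
  rewrite (bigID (mem (pos_part X)))/= -addrA; congr (_ + _).
  rewrite (bigID (mem (neg_part X)))/=; congr (_ + _); apply: eq_bigl => i;
    rewrite !finset.inE; have := sX i; rewrite !inE;
    by case/or3P => /eqP ->.
split=> [[s sseg <-]|[y yX ->]].
  have tP i : exists t : R, i \in zero_part X -> 0 <= t <= 1 /\
      s i = (1 - t) *: (- pe R i) + t *: pe R i.
    have [/sseg[t /= t01 <-]|_] := boolP (i \in zero_part X); last by exists 0.
    by exists t.
  pose t i := projT1 (cid (tP i)).
  have tE i : i \in zero_part X -> 0 <= t i <= 1 /\
      s i = (1 - t i) *: (- pe R i) + t i *: pe R i := projT2 (cid (tP i)).
  (* The parameter [t] of the segment from [- pe R i] to [pe R i] corresponds to the coordinate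
     [2 * t - 1]. *)
  exists (\row_i (if X i == 1 then 1 else if X i == -1 then -1 else 2 * t i - 1)).
    move=> i; rewrite mxE; have := sX i; rewrite !inE.
    have zi : X i == 0 -> 0 <= t i <= 1.
      by move=> Xi; have [] := tE i; rewrite ?finset.inE.
    case/or3P => /eqP Xi; rewrite Xi; split=> //=; do ?lra.
    by have /andP[] := zi (introT eqP Xi); lra.
  rewrite proj_sum split_sum; congr (_ + _ + _).
  - by apply: eq_bigr => i; rewrite finset.inE mxE => ->; rewrite scale1r.
  - rewrite -sumrN; apply: eq_bigr => i; rewrite finset.inE mxE => /eqP ->/=.
    by rewrite scaleN1r.
  - apply: eq_bigr => i iz; have [_ ->] := tE i iz; move: iz.
    rewrite finset.inE mxE => /eqP ->/=.
    by rewrite scalerN -scaleNr -scalerDl; congr (_ *: _); lra.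
exists (fun i => y ord0 i *: pe R i).
  move=> i _; exists ((y ord0 i + 1) / 2) => /=.
    by have [/andP[y1 y2] _ _] := yX i; apply/andP; split; lra.
  by rewrite scalerN -scaleNr -scalerDl; congr (_ *: _); lra.
rewrite proj_sum split_sum; congr (_ + _ + _).
- by apply: eq_bigr => i; rewrite finset.inE => /eqP Xi; have [_ -> //] := yX i; rewrite scale1r.
- rewrite -sumrN; apply: eq_bigr => i; rewrite finset.inE => /eqP Xi.
  by have [_ _ -> //] := yX i; rewrite scaleN1r.
Qed.

(** A difference of at least 2 forces the [k]-th and [j]-th cube coordinates to be opposite
    endpoints. Replacing the free coordinate [k] by 0 gives another point of the face, and
    prolonging from it beyond [x] would make the difference exceed 2 inside the face. *)
Lemma relint_face_coord X x k j : signed_subset X ->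
  relative_interior (face X) x -> X k = 0 -> `|x ord0 k - x ord0 j| < 2.
Proof.
move=> sX xri Xk; rewrite ltNge; apply/negP => xkj.
have [y yX xE] := (faceP x sX).1 xri.1.
pose y' := \row_i (if i == k then 0 else y ord0 i).
have y'X : face_coords X y'.
  move=> i; rewrite mxE; case: eqVneq => [->|_]; last exact: yX.
  by rewrite Xk; split=> //; lra.
have [e e0] := relative_interior_extend xri ((faceP _ sX).2 (ex_intro2 _ _ y' y'X erefl)).
move=> /(faceP _ sX)[z zX].
have kj : (j == k) = false.
  by apply/eqP => jk; move: xkj; rewrite jk subrr normr0; lra.
have -> : x + e *: (x - Defs.proj y') = Defs.proj (y + e *: (y - y')).
  by rewrite xE [RHS]linearD [in RHS]linearZ/= [in RHS]linearB.
move=> zE; have := proj_coord_diff z k j; rewrite -zE proj_coord_diff.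
have [/andP[y1 y2] _ _] := yX k; have [/andP[y3 y4] _ _] := yX j.
have [/andP[z1 z2] _ _] := zX k; have [/andP[z3 z4] _ _] := zX j.
move: xkj; rewrite xE proj_coord_diff !mxE eqxx kj subr0 subrr mulr0 addr0.
have eyk : (y ord0 k = 1 -> e * y ord0 k = e) by move=> ->; rewrite mulr1.
rewrite ler_normr => /orP[] h.
  have -> : y ord0 k = 1 by lra.
  lra.
have -> : y ord0 k = -1 by lra.
lra.
Qed.

(** Norm 1 makes the extremal coordinates of [x] differ by 2, so their cube coordinates are 1 and
    -1. [relint_face_coord] keeps these indices out of X^0, which fixes their signs. Conversely, a
    cube coordinate equal to 1 or -1 is extremal. *)
Lemma relint_face_argmax X x : signed_subset X -> `|x| = 1 ->
  relative_interior (face X) x -> pos_part X = argmax x /\ neg_part X = argmin x.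
Proof.
move=> sX x1 xri; have [y yX xE] := (faceP x sX).1 xri.1.
have [u uM] := argmax_ex x; have [w wm] := argmin_ex x.
have diff i j : x ord0 i - x ord0 j = y ord0 i - y ord0 j.
  by rewrite xE proj_coord_diff.
have extr i j : i \in argmax x -> j \in argmin x ->
    [/\ X i = 1, X j = -1, y ord0 i = 1 & y ord0 j = -1].
  move=> iM jm; have := norm_argmax_argmin iM jm; rewrite x1 diff => yij.
  have [/andP[_ yi] _ iN] := yX i; have [/andP[yj _] jP _] := yX j.
  have yi1 : y ord0 i = 1 by lra.
  have yj1 : y ord0 j = -1 by lra.
  have x2 : 2 <= `|x ord0 i - x ord0 j| by rewrite diff yi1 yj1 ler_normr; apply/orP; left; lra.
  have Xi0 : X i <> 0 by move=> /(relint_face_coord j sX xri); rewrite ltNge x2.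
  have Xj0 : X j <> 0.
    by move=> /(relint_face_coord i sX xri); rewrite distrC ltNge x2.
  split=> //.
    have := sX i; rewrite !inE => /or3P[] /eqP // Xi.
    by exfalso; have := iN Xi; lra.
  have := sX j; rewrite !inE => /or3P[] /eqP // Xj.
  by exfalso; have := jP Xj; lra.
split; apply/finset.setP => i.
  apply/idP/idP => [|iM]; last first.
    by rewrite finset.inE; have [-> _ _ _] := extr i w iM wm.
  rewrite finset.inE => /eqP Xi; have [_ /(_ Xi) yi _] := yX i.
  apply: mem_argmax => j; have [/andP[_ yj] _ _] := yX j.
  by have := diff i j; lra.
apply/idP/idP => [|im]; last first.
  by rewrite finset.inE; have [_ -> _ _] := extr u i uM im.
rewrite finset.inE => /eqP Xi; have [_ _ /(_ Xi) yi] := yX i.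
apply: mem_argmin => j; have [/andP[yj _] _ _] := yX j.
by have := diff i j; lra.
Qed.

Lemma argmaxZ x (c : R) : 0 < c -> argmax (c *: x) = argmax x.
Proof.
move=> c0; apply/finset.setP => i; rewrite !finset.inE max_coordZ ?ltW//.
by rewrite mxE (inj_eq (mulfI _))// gt_eqF.
Qed.

Lemma argminZ x (c : R) : 0 < c -> argmin (c *: x) = argmin x.
Proof.
have h y (d : R) j : 0 < d -> j \in argmin y -> j \in argmin (d *: y).
  move=> d0 jy; apply: mem_argmin => i; rewrite !mxE.
  by apply: ler_wpM2l; [exact: ltW|exact: argmin_le].
move=> c0; apply/finset.setP => i; apply/idP/idP => [|/h]; last exact.
by move=> /(h _ c^-1); rewrite scalerA mulVf ?gt_eqF// scale1r invr_gt0; exact.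
Qed.

Lemma relint_face_normalized X x : signed_subset X -> x != 0 ->
  relative_interior (face X) (`|x|^-1 *: x) ->
  pos_part X = argmax x /\ neg_part X = argmin x.
Proof.
move=> sX x0 /(relint_face_argmax sX)[].
  by rewrite normrZ normfV normr_id mulVf// normr_eq0.
by rewrite argmaxZ ?argminZ ?invr_gt0 ?normr_gt0.
Qed.

End RelativeInterior.

(** * The criterion for subfamilies and the theorem *)

Lemma star_SMT_iff (R : realType) (n k : nat) (p : 'I_k -> MZ R n)
    (J : {set 'I_k}) : injective p -> (forall i, p i != 0) ->
  SMT (0 |` [fset p i | i in J])%fset (star [fset p i | i in J]%fset) <->
  forall a b c d, a \in J -> b \in J -> c \in J -> d \in J ->
    a != c -> a != d -> b != c -> b != d ->
    (argmax (p a) :|: argmax (p c)) :&: (argmin (p b) :|: argmin (p d))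
      != finset.set0.
Proof.
move=> p_inj p0; set P := [fset p i | i in J]%fset.
have P0 : 0 \notin P.
  by apply/imfsetP => -[i _ /esym/eqP]; rewrite (negPf (p0 i)).
have pP i : i \in J -> p i \in P by move=> iJ; apply/imfsetP; exists i.
split=> [smt a b c d aJ bJ cJ dJ ac ad bc bd|good].
  apply/eqP => bad; apply: star_not_SMT P0 _ _ _ _ _ _ _ _ bad smt;
    by rewrite ?(inj_eq p_inj) ?pP.
have [str len] := star_tree P0.
split; first by split; rewrite // fsubset_refl.
move=> T [tT sT]; rewrite len (big_seq_fsetE _ _ xpredT (fun q => `|q|))/=.
(* The terminals are indexed by the point set [P] itself, so the required injectivity is that of
   [val]. *)
apply: (sum_norm_le_glength (p := fun q : P => val q)) tT _ _ => //.
- move=> a b c d ac ad bc bd.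
  have pre (q : P) : exists2 i, i \in J & val q = p i.
    by have /imfsetP[i iJ qE] := fsvalP q; exists i.
  have [ia aJ aE] := pre a; have [ib bJ bE] := pre b.
  have [ic cJ cE] := pre c; have [id dJ dE] := pre d.
  have ne (s t : P) i j : val s = p i -> val t = p j -> s != t -> i != j.
    by move=> sE tE; apply: contraNneq => ij; apply/eqP/val_inj; rewrite sE tE ij.
  rewrite aE bE cE dE.
  exact: (good _ _ _ _ aJ bJ cJ dJ (ne _ _ _ _ aE cE ac) (ne _ _ _ _ aE dE ad)
            (ne _ _ _ _ bE cE bc) (ne _ _ _ _ bE dE bd)).
- by apply: (fsubsetP sT); exact: fset1U1.
- by move=> q; apply: (fsubsetP sT); rewrite in_fset1U (fsvalP q) orbT.
Qed.

Theorem corollary22 (R : realType) (n k : nat)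
    (p : 'I_k -> MZ R n) (X : 'I_k -> {ffun 'I_n.+1 -> int})
    (p_inj : injective p) (p_neq0 : forall i, p i != 0)
    (XZ : forall i, Zfamily (X i))
    (pX : forall i, relative_interior (face (R := R) (X i)) (`|p i|^-1 *: p i)) :
  (SMT (0 |` [fset p i | i : 'I_k])%fset (star [fset p i | i : 'I_k]%fset) <->
   ~ exists a b c d : 'I_k,
       [set a; b]%SET :&: [set c; d]%SET = finset.set0 /\
       (pos_part (X a) :|: pos_part (X c)) :&:
       (neg_part (X b) :|: neg_part (X d)) = finset.set0) /\
  (SMT (0 |` [fset p i | i : 'I_k])%fset (star [fset p i | i : 'I_k]%fset) <->
   forall I : {set 'I_k}, (2 <= #|I| <= 4)%N ->
     SMT (0 |` [fset p i | i in I])%fset (star [fset p i | i in I]%fset)).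
Proof.
have posE i : pos_part (X i) = argmax (p i).
  by have [] := relint_face_normalized (XZ i).1 (p_neq0 i) (pX i).
have negE i : neg_part (X i) = argmin (p i).
  by have [] := relint_face_normalized (XZ i).1 (p_neq0 i) (pX i).
have -> : [fset p i | i : 'I_k]%fset = [fset p i | i in [set: 'I_k]%SET]%fset.
  by apply/fsetP => q; apply/imfsetP/imfsetP => -[i _ ->]; exists i; rewrite ?finset.inE.
have disj (a b c d : 'I_k) : [set a; b]%SET :&: [set c; d]%SET = finset.set0 <->
    [/\ a != c, a != d, b != c & b != d].
  split=> [/eqP|[ac ad bc bd]].
    rewrite finset.setI_eq0 finset.disjoints_subset.
    move=> /fintype.subsetP h; have := h a; have := h b.
    rewrite !finset.inE !eqxx orbT/= => /(_ isT) + /(_ isT).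
    by rewrite !negb_or => /andP[bc bd] /andP[ac ad].
  apply/eqP; rewrite finset.setI_eq0 finset.disjoints_subset; apply/fintype.subsetP => i.
  by rewrite !finset.inE negb_or => /orP[] /eqP ->; rewrite ?ac ?bc.
have SMT_sub J := star_SMT_iff J p_inj p_neq0.
split; [split|split].
- move=> /SMT_sub good [a [b [c [d [/disj[ac ad bc bd]]]]]].
  rewrite !posE !negE => /eqP; apply/negP.
  by apply: good; rewrite ?finset.inE.
- move=> nbad; apply/SMT_sub => a b c d _ _ _ _ ac ad bc bd.
  apply/eqP => bad; apply: nbad; exists a, b, c, d.
  by rewrite !posE !negE; split=> //; apply/disj.
- move=> /SMT_sub good I _; apply/SMT_sub => a b c d _ _ _ _.
  by apply: good; rewrite finset.inE.
- move=> sub; apply/SMT_sub => a b c d _ _ _ _ ac ad bc bd.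
  (* A forbidden quadruple already lives in the subfamily of its own indices, which has at least two
     elements because [a != c]. *)
  have /sub/SMT_sub : (2 <= #|[set a; b; c; d]%SET| <= 4)%N.
    apply/andP; split.
      apply: (@leq_trans #|[set a; c]%SET|); first by rewrite cards2 ac.
      apply: subset_leq_card; apply/fintype.subsetP => i.
      by rewrite !finset.inE => /orP[] ->; rewrite ?orbT.
    apply: leq_trans (card_size [:: a; b; c; d]); apply/subset_leq_card.
    by apply/fintype.subsetP => i; rewrite !inE -!orbA.
  by apply; rewrite // !finset.inE eqxx ?orbT.
Qed.
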